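(* Let $\gamma=(\gamma_1,\dots,\gamma_d)\vdash n$ and $1\le m\le n$. Then $$\mu_{n,m}(\gamma)=|\mathcal{C}_\gamma|\sum_{k=0}^{n-m}\frac{(-1)^k{m+k\brack m}}{(m+k)!}\sum_{\substack{k_1+\cdots+k_d=n-m-k+1\\ k_1>0,\dots,k_d>0}}\prod_{i=1}^d\binom{\gamma_i}{k_i}.$$
   Context: Fix $\omega=(1\,2\,\cdots\,n)$. For a partition $\gamma\vdash n$ and integer $m\ge1$, $\mu_{n,m}(\gamma)$ is the number of pairs $(\sigma,\pi)$ of permutations of $[n]$ with $\sigma\pi=\omega$ (product right to left), $\sigma$ of cycle type $\gamma$, and $\pi$ having exactly $m$ cycles (equivalently, the number of $\sigma$ of cycle type $\gamma$ such that $\sigma^{-1}\omega$ has $m$ cycles). $\mathcal{C}_\gamma$ is the conjugacy class of permutations of cycle type $\gamma$, so $|\mathcal{C}_\gamma|=n!/z_\gamma$ with $z_\gamma=\prod_i i^{a_i}a_i!$ when $\gamma=[1^{a_1},\dots,n^{a_n}]$. ${n\brack k}$ denotes the unsigned Stirling number of the first kind (number of permutations of $[n]$ with $k$ cycles). *)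

(* Defs.v *)
From mathcomp Require Import all_boot all_order all_algebra all_fingroup.
Set Implicit Arguments. Unset Strict Implicit. Unset Printing Implicit Defensive.

(* Points 1..n are represented by 'I_n = {0,..,n-1} (point i+1 <-> i). *)

Definition omega (n : nat) : 'S_n := perm (@ordS_inj n).

(* number of cycles of a permutation (fixed points count as 1-cycles) *)
Definition ncycles n (s : 'S_n) : nat := #|porbits s|.

Definition cycle_type n (s : 'S_n) : seq nat :=
  sort geq [seq #|X| | X : {set 'I_n} <- enum (porbits s)].

Definition is_partition (n : nat) (g : seq nat) : bool :=
  [&& all (fun x => 0 < x) g, sorted geq g & sumn g == n].

Definition conj_class n (g : seq nat) : {set 'S_n} :=
  [set s : 'S_n | cycle_type s == g].

Definition stirling1 (n k : nat) : nat := #|[set s : 'S_n | ncycles s == k]|.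

(* mu_{n,m}(gamma): number of pairs (sigma, pi) with sigma pi = omega (product
   right to left, i.e. pi is applied first), sigma of type gamma, pi with m
   cycles.  pi is determined by sigma: pi = sigma^{-1} o omega, which in
   MathComp's left-to-right product notation is omega * sigma^-1. *)
Definition mu n m (g : seq nat) : nat :=
  #|[set s : 'S_n | (cycle_type s == g) && (ncycles (omega n * s^-1) == m)]|.

(* Main.v *)
Require Import Defs.
From mathcomp Require Import all_boot all_order all_algebra all_fingroup.
From mathcomp Require Import ring zify.
Set Implicit Arguments. Unset Strict Implicit. Unset Printing Implicit Defensive.
Import GRing.Theory Num.Theory.
Local Open Scope ring_scope.

(** For every N > 0, the sum of N ^ cycles(s^-1 omega) over the class of type g
    is the size of the class times the coefficient of X^(n+1) in
    (1+X)^N * \prod_i ((1+X)^(g_i) - 1).  Comparing both sides as polynomials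
    in N gives the theorem, since (-1)^(j-m) [j, m] / j! is the coefficient of
    N^m in 'C(N, j).
    By conjugation, omega may be averaged over the products of transpositions
    (x_1 j_1)(x_2 j_2)..., each joining a new point x_i to an earlier j_i; these
    products are full cycles.  For this average, deleting the point x
    from s yields a recursion in which the cycle of s through x gets shortened,
    then merged with another cycle or split in two, and a differential identity
    in (1+X) shows that the coefficients obey the same recursion. *)

(** * Cycles of a permutation multiplied by a transposition *)

Lemma fcycle_porbit (T : finType) (s : {perm T}) (p : seq T) x :
  fcycle s p -> uniq p -> x \in p -> porbit s x =i p.
Proof.
move=> sp up xp y; rewrite -(fconnect_cycle sp xp).
apply/porbitP/idP => [[i ->]|/iter_findex <-]; first by rewrite permX fconnect_iter.
by eexists; rewrite permX.
Qed.

Lemma porbit_mul_tperm_notin (T : finType) (s : {perm T}) j k z :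
  j \notin porbit s z -> k \notin porbit s z ->
  porbit (tperm j k * s) z = porbit s z.
Proof.
move=> jz kz.
have exp_id i : ((tperm j k * s) ^+ i)%g z = (s ^+ i)%g z.
  elim: i => [|i IHi]; first by rewrite !expg0.
  rewrite !expgSr !permM IHi tpermD //.
    by apply: contraNneq jz => ->; apply: mem_porbit.
  by apply: contraNneq kz => ->; apply: mem_porbit.
apply/porbit_setP => y; apply/idP/idP => /porbitP[i ->].
  by rewrite exp_id mem_porbit.
by rewrite -exp_id mem_porbit.
Qed.

(** If the points were still separated, multiplying by the transposition twice would lower the
    number of cycles by two, yet it gives back [s]. *)
Lemma porbit_merge_mem (T : finType) (s : {perm T}) j k :
  j \notin porbit s k -> j \in porbit (tperm j k * s) k.
Proof.
move=> jk.
have ne_jk : j != k by apply: contraNneq jk => ->; apply: porbit_id.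
have := porbits_mul_tperm s j k; have := porbits_mul_tperm (tperm j k * s) j k.
rewrite /= tpermKg jk ne_jk; case: (_ \in _) => //=; lia.
Qed.

(** Both inclusions follow by contraposition from [porbit_mul_tperm_notin], applied to [s] and, as
    the transposition is an involution, to the product. *)
Lemma porbit_merge (T : finType) (s : {perm T}) j k :
  j \notin porbit s k ->
  porbit (tperm j k * s) k = porbit s j :|: porbit s k.
Proof.
move=> jk; set v := (tperm j k * s)%g.
have sE : s = (tperm j k * v)%g by rewrite /v tpermKg.
have jv : j \in porbit v k by exact: porbit_merge_mem.
have /eqP jvE : porbit v j == porbit v k by rewrite eq_porbit_mem.
apply/setP => z; rewrite inE; apply/idP/idP => [zv|].
  apply/contraT; rewrite negb_or => /andP[zj zk].
  have vz : porbit v z = porbit s z.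
    by apply: porbit_mul_tperm_notin; rewrite porbit_sym.
  by move: zk; rewrite porbit_sym -vz porbit_sym zv.
apply: contraLR => zv.
have svz : porbit s z = porbit v z.
  rewrite {1}sE; apply: porbit_mul_tperm_notin; rewrite porbit_sym //.
  by rewrite jvE.
by rewrite negb_or !(porbit_sym s z) svz !(porbit_sym v _ z) jvE zv.
Qed.

Lemma porbits_merge (T : finType) (s : {perm T}) j k :
  j \notin porbit s k ->
  porbits (tperm j k * s) =
    (porbit s j :|: porbit s k) |: (porbits s :\ porbit s k :\ porbit s j).
Proof.
move=> jk; have vk := porbit_merge jk.
have /eqP jvE : porbit (tperm j k * s) j == porbit (tperm j k * s) k.
  by rewrite eq_porbit_mem porbit_merge_mem.
apply/setP => C; rewrite !inE; apply/imsetP/idP => [[z _ ->]|].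
  have [zjk|] := boolP (z \in porbit s j :|: porbit s k).
    by rewrite -vk eq_porbit_mem vk zjk.
  rewrite inE negb_or => /andP[zj zk].
  rewrite porbit_mul_tperm_notin 1?porbit_sym // !eq_porbit_mem zj zk /=.
  by rewrite imset_f ?orbT.
case/predU1P => [->|/and3P[+ + /imsetP[z _ zC]]]; first by exists k.
rewrite zC !eq_porbit_mem => zj zk; exists z => //.
by rewrite porbit_mul_tperm_notin // porbit_sym.
Qed.

Lemma fcycle_traject (T : eqType) (f : T -> T) x n :
  iter n f x = x -> fcycle f (traject f x n).
Proof.
case: n => //= n xn.
by rewrite rcons_path fpath_traject last_traject /= xn eqxx.
Qed.

Lemma iter_porbit_inj (T : finType) (s : {perm T}) k :
  {in gtn #|porbit s k| &, injective (fun i => iter i s k)}.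
Proof.
move=> i l; rewrite !inE /= => i_lt l_lt /eqP.
rewrite -(nth_traject s i_lt) -(nth_traject s l_lt).
by rewrite nth_uniq ?size_traject ?uniq_traject_porbit // => /eqP.
Qed.

(** The product sends [j] to [s k] and then follows [s] until it reaches [j] again, so
    [s k, ..., iter i s k = j] is a cycle of length [i] avoiding [k]. *)
Lemma porbit_split (T : finType) (s : {perm T}) k i :
  (0 < i < #|porbit s k|)%N ->
  let j := iter i s k in
  j \notin porbit (tperm j k * s) k /\ #|porbit (tperm j k * s) j| = i.
Proof.
move=> /andP[i_gt0 i_lt] j; set v := (tperm j k * s)%g.
have vj : v j = s k by rewrite /v permM tpermL.
have ne l m : (l < #|porbit s k|)%N -> (m < #|porbit s k|)%N -> l != m ->
    iter l s k != iter m s k.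
  by move=> l_lt m_lt; apply: contraNneq => /iter_porbit_inj ->.
have iv l : (l < i)%N -> iter l v (s k) = iter l s (s k).
  elim: l => //= l IHl l_lt; rewrite IHl 1?ltnW // /v permM -!iterSr tpermD //.
    by apply: ne; lia.
  by apply: (ne 0%N l.+1); lia.
have tv : traject v (s k) i = traject s (s k) i.
  apply: (@eq_from_nth _ (s k)); first by rewrite !size_traject.
  by rewrite size_traject => l l_lt; rewrite !nth_traject // iv.
have ivi : iter i v (s k) = s k.
  case: i i_gt0 @j {i_lt ne tv} @v vj iv => // i _ j v vj iv.
  by rewrite iterS iv // -iterSr vj.
have jt : j \in traject s (s k) i.
  case: i i_gt0 @j {i_lt ne tv ivi} @v vj iv => // i _ j v vj iv.
  by apply/trajectP; exists i; rewrite // -iterSr.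
have ut : uniq (traject s (s k) i) /\ k \notin traject s (s k) i.
  have := uniq_traject_porbit s k.
  case: #|_| i_lt => // a i_lt /= /andP[]; rewrite -(subnKC (i_lt : (i <= a)%N)) trajectD.
  by rewrite cat_uniq mem_cat negb_or => /andP[-> _] /andP[-> _].
case: ut => ut kt.
have pj : porbit v j =i traject s (s k) i.
  by apply: fcycle_porbit; rewrite // -tv; apply: fcycle_traject.
split; first by rewrite porbit_sym pj.
by rewrite (eq_card pj) (card_uniqP _) ?size_traject.
Qed.

Lemma fixed_porbit (T : finType) (s : {perm T}) x :
  s x = x -> porbit s x = [set x].
Proof.
move=> sx; apply/setP => y; rewrite inE (@fcycle_porbit _ s [:: x]) ?inE //=.
by rewrite sx eqxx.
Qed.

Lemma fixed_notin_porbit (T : finType) (s : {perm T}) x k :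
  s x = x -> x != k -> x \notin porbit s k.
Proof. by move=> sx xk; rewrite porbit_sym fixed_porbit // inE eq_sym. Qed.

(** All cycles but the two merged ones survive. Read backwards, this also describes splitting. *)
Lemma porbits_mergeD1 (T : finType) (s : {perm T}) j k :
  j \notin porbit s k ->
  porbits (tperm j k * s) :\ porbit (tperm j k * s) k =
    porbits s :\ porbit s k :\ porbit s j.
Proof.
move=> jk; rewrite (porbits_merge jk) (porbit_merge jk) setU1K //.
rewrite !inE; apply/negP => /and3P[/eqP + _ /imsetP[z _ UE]]; rewrite UE.
have: j \in porbit s z by rewrite -UE inE porbit_id.
by rewrite -eq_porbit_mem => /eqP ->.
Qed.

(** * The polynomial of a set of cycles *)

(** Each factor is the sum of ['C(#|C|, k) X^k] over [k > 0]. Taking a set of cycles as argument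
    allows single cycles to be removed. *)
Definition cycle_poly (T : finType) (A : {set {set T}}) : {poly rat} :=
  \prod_(C in A) ((1 + 'X) ^+ #|C| - 1).

Lemma cycle_polyD1 (T : finType) (A : {set {set T}}) C : C \in A ->
  cycle_poly A = ((1 + 'X) ^+ #|C| - 1) * cycle_poly (A :\ C).
Proof. by move=> CA; rewrite /cycle_poly (big_setD1 C). Qed.

Lemma card_porbit_merge (T : finType) (s : {perm T}) j k :
  j \notin porbit s k ->
  #|porbit (tperm j k * s) k| = (#|porbit s j| + #|porbit s k|)%N.
Proof.
move=> jk; rewrite (porbit_merge jk) cardsU.
suff -> : porbit s j :&: porbit s k = set0 by rewrite cards0 subn0.
apply/setP => z; rewrite !inE; apply: contraNF jk => /andP[].
by rewrite -!eq_porbit_mem => /eqP <-.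
Qed.

Lemma cycle_poly_merge (T : finType) (s : {perm T}) j k :
  j \notin porbit s k ->
  cycle_poly (porbits (tperm j k * s)) =
    ((1 + 'X) ^+ (#|porbit s j| + #|porbit s k|) - 1) *
    cycle_poly (porbits s :\ porbit s k :\ porbit s j).
Proof.
move=> jk; rewrite -(card_porbit_merge jk) -(porbits_mergeD1 jk).
by apply: cycle_polyD1; apply: imset_f.
Qed.

(** Splitting is merging undone: multiplying [v] by the same transposition merges the two parts back
    into the cycle of [k] under [s]. *)
Lemma cycle_poly_split (T : finType) (s : {perm T}) k i :
  (0 < i < #|porbit s k|)%N ->
  cycle_poly (porbits (tperm (iter i s k) k * s)) =
    ((1 + 'X) ^+ i - 1) * ((1 + 'X) ^+ (#|porbit s k| - i) - 1) *
    cycle_poly (porbits s :\ porbit s k).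
Proof.
move=> i_in; have [jk ij] := porbit_split i_in.
set j := iter i s k in jk ij *; set v := (tperm j k * s)%g in jk ij *.
have := card_porbit_merge jk; have := porbits_mergeD1 jk.
rewrite tpermKg ij => -> ->; rewrite addKn.
rewrite (@cycle_polyD1 _ (porbits v) (porbit v k)) ?imset_f //.
rewrite (@cycle_polyD1 _ _ (porbit v j)) ?ij; first by rewrite mulrCA mulrA.
by rewrite !inE eq_porbit_mem jk imset_f.
Qed.

Lemma deriv_prod_set (R : comNzRingType) (I : finType) (A : {set I})
    (F : I -> {poly R}) :
  (\prod_(i in A) F i)^`() =
    \sum_(i in A) (F i)^`() * \prod_(j in A :\ i) F j.
Proof.
have [n] := ubnP #|A|; elim: n A => // n IHn A /ltnSE leAn.
have [->|[x xA]] := set_0Vmem A; first by rewrite !big_set0 derivC.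
rewrite (big_setD1 x xA) [RHS](big_setD1 x xA) /= derivM IHn; last first.
  by move: leAn; rewrite (cardsD1 x) xA.
congr (_ + _); rewrite mulr_sumr; apply: eq_bigr => i; rewrite !inE => /andP[ix iA].
rewrite mulrCA; congr (_ * _); rewrite [RHS](big_setD1 x) ?inE 1?eq_sym ?ix //.
by congr (_ * _); apply: eq_bigl => j; rewrite !inE andbCA.
Qed.

(** The operator [(1 + X) d/dX] multiplies [(1 + X)^c] by [c], so no exponent drops. *)
Lemma deriv_cycle_poly (T : finType) (A : {set {set T}}) :
  (1 + 'X) * (cycle_poly A)^`() =
  \sum_(C in A) #|C|%:R * (1 + 'X) ^+ #|C| * cycle_poly (A :\ C).
Proof.
rewrite deriv_prod_set mulr_sumr; apply: eq_bigr => C CA; rewrite mulrA.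
congr (_ * _); case: #|C| => [|c]; first by rewrite expr0 subrr linear0 mulr0 !mul0r.
rewrite derivB deriv_exp derivD derivX !derivC add0r subr0 mul1r /=.
by rewrite -mulr_natr exprS; ring.
Qed.

(** * Sums over all transpositions moving a given point *)

(** The points [j] are the [iter i s k] with [0 < i < a], which cut the cycle into lengths [i] and
    [a - i]. The expanded products give geometric sums in [1 + X], and the factor [X] clears their
    denominator. *)
Lemma sum_cycle_poly_split (T : finType) (s : {perm T}) k :
  let a := #|porbit s k| in
  'X * \sum_(j in porbit s k | j != k) cycle_poly (porbits (tperm j k * s)) =
    ('X * ((a%:R - 1) * ((1 + 'X) ^+ a + 1)) - 2%:R * ((1 + 'X) ^+ a - (1 + 'X)))
    * cycle_poly (porbits s :\ porbit s k).
Proof.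
move=> a; set R := cycle_poly _.
have -> : \sum_(j in porbit s k | j != k) cycle_poly (porbits (tperm j k * s)) =
    \sum_(1 <= i < a) ((1 + 'X) ^+ i - 1) * ((1 + 'X) ^+ (a - i) - 1) * R.
  rewrite (eq_bigl [in [predD1 (traject s k a) & k]]); last first.
    by move=> j; rewrite !inE porbit_traject andbC.
  have ut := uniq_traject_porbit s k; rewrite -/a in ut.
  have a_gt0 : (0 < a)%N by rewrite lt0n card_porbit_neq0.
  have [b aE] : exists b, a = b.+1 by exists a.-1; lia.
  (* Dropping the first point [k] leaves the trajectory of [s k], of length [b = a - 1]. *)
  rewrite (eq_bigl [in traject s (s k) b]); last first.
    move: ut => + j; rewrite aE /= !inE => /andP[kt _].
    by case: eqP => //= ->; rewrite (negbTE kt).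
  rewrite -big_uniq; last by move: ut; rewrite aE => /andP[].
  rewrite (big_nth (s k)) size_traject aE big_add1 /= !big_mkord.
  apply: eq_bigr => i _; rewrite nth_traject // -iterSr.
  by rewrite cycle_poly_split -/a ?aE //= ltnS ltn_ord.
have a_gt0 : (0 < a)%N by rewrite lt0n card_porbit_neq0.
rewrite -mulr_suml mulrA; congr (_ * _).
case: (a) a_gt0 => // b _; rewrite big_add1 /= big_mkord.
have geo n : 'X * \sum_(i < n) (1 + 'X) ^+ i = (1 + 'X) ^+ n - 1 :> {poly rat}.
  by rewrite subrX1 addrAC subrr add0r.
have geo1 : 'X * \sum_(i < b) (1 + 'X) ^+ i.+1 = (1 + 'X) ^+ b.+1 - (1 + 'X) :> {poly rat}.
  have := geo b.+1; rewrite big_ord_recl /= expr0 mulrDr mulr1.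
  by move/(canRL (addKr _)) => ->; ring.
have geo2 : \sum_(i < b) (1 + 'X) ^+ (b - i) = \sum_(i < b) (1 + 'X) ^+ i.+1 :> {poly rat}.
  rewrite (reindex_inj rev_ord_inj); apply: eq_bigr => i _ /=.
  by congr (_ ^+ _); have := ltn_ord i; lia.
have -> : \sum_(i < b) ((1 + 'X) ^+ i.+1 - 1) * ((1 + 'X) ^+ (b.+1 - i.+1) - 1) =
    \sum_(i < b) ((1 + 'X) ^+ b.+1 + 1)
    - \sum_(i < b) (1 + 'X) ^+ i.+1 - \sum_(i < b) (1 + 'X) ^+ (b - i) :> {poly rat}.
  rewrite -!sumrB; apply: eq_bigr => i _.
  have -> : b.+1 = (i.+1 + (b - i))%N by have := ltn_ord i; lia.
  by rewrite exprD addKn; ring.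
rewrite geo2 sumr_const card_ord -[(_ + 1) *+ b]mulr_natl !mulrBr geo1 -natr1; ring.
Qed.

Lemma sum_notin_porbit (T : finType) (V : nmodType) (s : {perm T}) k
    (G : {set T} -> V) :
  \sum_(j | j \notin porbit s k) G (porbit s j) =
  \sum_(C in porbits s :\ porbit s k) G C *+ #|C|.
Proof.
set A := porbits s :\ porbit s k.
rewrite (partition_big (porbit s) (mem A)); last first.
  by move=> j jk; rewrite !inE eq_porbit_mem jk imset_f.
apply: eq_bigr => C; rewrite !inE => /andP[Ck /imsetP[z _ Cz]].
rewrite (eq_big [in C] (fun=> G C)) ?sumr_const // => j; last by case/andP=> _ /eqP ->.
rewrite Cz eq_porbit_mem; apply: andb_idl; rewrite -eq_porbit_mem => /eqP jz.
by rewrite -eq_porbit_mem jz -Cz.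
Qed.

(** With [w = 1 + X], [w^(c+a) - 1 = (w^a - 1) w^c + (w^c - 1)]. Weighted by the size [c] of the
    other cycle, the first terms add up to a derivative of [R], the second ones to [R] times the
    number of points outside the cycle of [k]. *)
Lemma sum_cycle_poly_merge (T : finType) (s : {perm T}) k :
  let a := #|porbit s k| in let R := cycle_poly (porbits s :\ porbit s k) in
  \sum_(j | j \notin porbit s k) cycle_poly (porbits (tperm j k * s)) =
    ((1 + 'X) ^+ a - 1) * ((1 + 'X) * R^`()) + (#|T|%:R - a%:R) * R.
Proof.
move=> a R; set A := porbits s :\ porbit s k.
have -> : \sum_(j | j \notin porbit s k) cycle_poly (porbits (tperm j k * s)) =
    \sum_(C in A) (((1 + 'X) ^+ (#|C| + a) - 1) * cycle_poly (A :\ C)) *+ #|C|.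
  rewrite -sum_notin_porbit; apply: eq_bigr => j jk.
  by rewrite cycle_poly_merge.
have -> : #|T|%:R - a%:R = (\sum_(C in A) #|C|%:R) :> {poly rat}.
  rewrite -(sum_notin_porbit _ _ (fun=> 1)) sumr_const -natrB ?max_card //.
  congr (_%:R); rewrite -(cardC [in porbit s k]) addKn.
  by apply: eq_card => j; rewrite !inE.
rewrite deriv_cycle_poly mulr_sumr mulr_suml -big_split; apply: eq_bigr => C CA /=.
by rewrite /R (cycle_polyD1 CA) exprD -mulr_natl; ring.
Qed.

(** * The recursion for the coefficients *)

Definition cycle_coef (T : finType) N (s : {perm T}) : rat :=
  ((1 + 'X) ^+ N * cycle_poly (porbits s))`_(#|T|.+1).

(** Here [tperm x k * s] is [s] with the fixed point [x] inserted into the cycle of [k]. In the sum,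
    the [j] in that cycle split it and the others merge it with another cycle. *)
Lemma cycle_coef_rec (T : finType) N (s : {perm T}) x k :
  s x = x -> x != k ->
  #|T|%:R * cycle_coef N (tperm x k * s) =
  N%:R * cycle_coef N s + \sum_(j | j != k) cycle_coef N (tperm j k * s).
Proof.
move=> sx xk; set n := #|T|; set a := #|porbit s k|.
have porbitx := fixed_porbit sx; have xnk := fixed_notin_porbit sx xk.
have xA : porbit s x \in porbits s :\ porbit s k.
  by rewrite !inE eq_porbit_mem xnk imset_f.
set Q := cycle_poly (porbits s :\ porbit s k :\ porbit s x).
set R := cycle_poly (porbits s :\ porbit s k).
have RE : R = 'X * Q by rewrite /R (cycle_polyD1 xA) -/Q porbitx cards1 expr1; ring.
pose W : {poly rat} := (1 + 'X) ^+ N; pose V : {poly rat} := (1 + 'X) ^+ a.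
(* The coefficient of X^(n+1) in [X p' - (n+1) p] vanishes for every p: up to
   such terms the right-hand side below is n P1. *)
pose P1 := W * ((1 + 'X) * V - 1) * Q; pose U := W * 'X * Q.
have sumE : N%:R * (W * cycle_poly (porbits s)) +
    \sum_(j | j != k) W * cycle_poly (porbits (tperm j k * s)) =
    'X * P1^`() - P1 - 'X * U^`() + n.+1%:R * U.
  rewrite -mulr_sumr (bigID [in porbit s k]) /=.
  have -> : \sum_(j | (j != k) && (j \notin porbit s k))
      cycle_poly (porbits (tperm j k * s)) =
      \sum_(j | j \notin porbit s k) cycle_poly (porbits (tperm j k * s)).
    apply: eq_bigl => j; apply: andb_idl; apply: contraNneq => ->.
    exact: porbit_id.
  rewrite sum_cycle_poly_merge -/R.
  under eq_bigl do rewrite andbC.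
  have -> : \sum_(i in porbit s k | i != k) cycle_poly (porbits (tperm i k * s)) =
      ('X * ((a%:R - 1) * (V + 1)) - 2%:R * (V - (1 + 'X))) * Q.
    (* The factor [X] of the splitting formula cancels against the one in [R = 'X * Q], due to the
       fixed point [x]. *)
    apply: (mulfI (negbT (polyX_eq0 rat))).
    by rewrite sum_cycle_poly_split -/R RE mulrCA.
  rewrite (@cycle_polyD1 _ (porbits s) (porbit s k)) ?imset_f // -/R RE -/a -/n -/V.
  have deriv_w M : (1 + 'X) * ((1 + 'X) ^+ M)^`() = M%:R * (1 + 'X) ^+ M :> {poly rat}.
    case: M => [|M]; first by rewrite expr0 derivC mulr0 mul0r.
    rewrite deriv_exp derivD derivX derivC add0r mul1r -mulr_natl exprS.
    by rewrite mulrCA.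
  have wW : (1 + 'X) * W^`() = N%:R * W by apply: deriv_w.
  have wV : (1 + 'X) * V^`() = a%:R * V by apply: deriv_w.
  rewrite /P1 /U !(derivM, derivD, derivB, derivX, derivN, derivC) -(natr1 n).
  (* The derivatives become free variables, related to [W] and [V] only by [wW] and [wV]; the
     intermediate form exhibits the left-hand sides of these two equations. *)
  move: (W^`()) (V^`()) (Q^`()) wW wV => W' V' Q' wW wV.
  transitivity ('X * ((1 + 'X) * W') * Q * (V - 1)
    + 'X * W * (V * Q + (1 + 'X) * V' * Q + ((1 + 'X) * V - 1) * Q')
    - W * ((1 + 'X) * V - 1) * Q - 'X * W * Q - 'X ^+ 2 * W * Q' + (n%:R + 1) * (W * 'X * Q)); last by ring.
  by rewrite wW wV; ring.
have Xd (p : {poly rat}) : ('X * p^`())`_n.+1 = n.+1%:R * p`_n.+1.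
  by rewrite coefXM coef_deriv mulr_natl.
have := congr1 (fun p : {poly rat} => p`_n.+1) sumE.
rewrite !(coefD, coefB, coefN) !Xd !mulr_natl !coefMn coef_sum.
have -> : P1`_n.+1 = cycle_coef N (tperm x k * s).
  rewrite /cycle_coef cycle_poly_merge // -/Q porbitx cards1 -/a add1n exprS.
  by rewrite /P1 -mulrA.
by move=> E; apply: etrans (esym E); rewrite mulrSr; ring.
Qed.

(** * Conjugation, fixed points and numbers of cycles *)

Lemma porbit_conj (T : finType) (s c : {perm T}) x :
  porbit (s ^ c) (c x) = c @: porbit s x.
Proof.
apply/setP => y; apply/porbitP/imsetP => [[i ->]|[_ /porbitP[i ->] ->]].
  by exists ((s ^+ i)%g x); rewrite ?mem_porbit // -conjXg permJ.
by exists i; rewrite -conjXg permJ.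
Qed.

Lemma porbits_conj (T : finType) (s c : {perm T}) :
  porbits (s ^ c) = [set c @: C | C : {set T} in porbits s].
Proof.
rewrite /porbits -imset_comp; apply/setP => C.
apply/imsetP/imsetP => -[x _ ->].
  by exists ((c^-1)%g x); rewrite //= -porbit_conj permKV.
by exists (c x); rewrite //= porbit_conj.
Qed.

Lemma card_porbits_conj (T : finType) (s c : {perm T}) :
  #|porbits (s ^ c)| = #|porbits s|.
Proof. rewrite porbits_conj card_imset //; apply: imset_inj; exact: perm_inj. Qed.

Lemma card_porbits_mulC (T : finType) (s t : {perm T}) :
  #|porbits (s * t)| = #|porbits (t * s)|.
Proof.
have -> : (t * s = (s * t) ^ s)%g by rewrite conjgE mulgA mulKg.
by rewrite card_porbits_conj.
Qed.

Lemma card_porbits_mul_fixed (T : finType) (s : {perm T}) x k :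
  s x = x -> x != k -> #|porbits (tperm x k * s)|.+1 = #|porbits s|.
Proof.
move=> sx xk; have := porbits_mul_tperm s x k.
rewrite /= fixed_notin_porbit // xk; lia.
Qed.

Lemma card_porbits1 (T : finType) : #|porbits (1 : {perm T})| = #|T|.
Proof.
rewrite card_imset // => x y /eqP; rewrite eq_porbit_mem.
by rewrite fixed_porbit ?perm1 // inE => /eqP.
Qed.

(** The factor [X] stands for the lost fixed point. As [x] is absent from the right-hand side, any
    two fixed points are interchangeable. *)
Lemma cycle_poly_fixed (T : finType) (s : {perm T}) x k :
  s x = x -> x != k ->
  'X * cycle_poly (porbits (tperm x k * s)) =
    ((1 + 'X) ^+ #|porbit s k|.+1 - 1) * cycle_poly (porbits s :\ porbit s k).
Proof.
move=> sx xk; have xnk := fixed_notin_porbit sx xk.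
rewrite cycle_poly_merge // (@cycle_polyD1 _ (_ :\ porbit s k) (porbit s x)); last first.
  by rewrite !inE eq_porbit_mem xnk imset_f.
by rewrite fixed_porbit // cards1 add1n expr1; ring.
Qed.

(** * Products of transpositions attaching points one by one *)

(** Points are attached from the end of [e]: each one is joined to [x0] or to an entry after it. The
    result is a list, so sums count products with multiplicity. *)
Fixpoint star_products (T : finType) x0 (e : seq T) : seq {perm T} :=
  if e is x :: e' then
    [seq (t * tperm x j)%g | j <- x0 :: e', t <- star_products x0 e']
  else [:: 1%g].

Lemma star_products_cons (T : finType) (x0 x : T) e :
  star_products x0 (x :: e) =
  [seq (t * tperm x j)%g | j <- x0 :: e, t <- star_products x0 e].
Proof. by []. Qed.

Lemma size_star_products (T : finType) (x0 : T) e :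
  size (star_products x0 e) = (size e)`!.
Proof. by elim: e => // x e IHe; rewrite star_products_cons size_allpairs IHe factS. Qed.

Lemma star_product_fix (T : finType) (x0 : T) e t z :
  t \in star_products x0 e -> z \notin x0 :: e -> t z = z.
Proof.
elim: e t => [|x e IHe] t; first by rewrite inE => /eqP ->; rewrite perm1.
rewrite star_products_cons => /allpairsP[[j u] [/= jE uE ->]].
rewrite !inE !negb_or => /and3P[z0 zx ze].
have zE : z \notin x0 :: e by rewrite inE negb_or z0.
rewrite permM (IHe u) // tpermD 1?eq_sym //.
by apply: contraNneq zE => ->.
Qed.

(** Each attached point costs one cycle; once [x0 :: e] exhausts [T], a single cycle remains. *)
Lemma card_porbits_star_product (T : finType) (x0 : T) e t :
  uniq (x0 :: e) -> t \in star_products x0 e -> (#|porbits t| + size e)%N = #|T|.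
Proof.
elim: e t => [|x e IHe] t.
  move=> _; rewrite inE => /eqP ->; rewrite addn0.
  exact: card_porbits1.
rewrite [uniq _]/= inE negb_or => /andP[/andP[x0x x0e] /andP[xe ue]].
rewrite star_products_cons => /allpairsP[[j u] [/= jE uE ->]].
have xE : x \notin x0 :: e by rewrite inE negb_or eq_sym x0x.
have uniqE : uniq (x0 :: e) by rewrite /= x0e.
rewrite card_porbits_mulC -(IHe u uniqE uE) addnS -addSn.
rewrite card_porbits_mul_fixed ?(star_product_fix uE) //.
by apply: contraNneq xE => ->.
Qed.

Definition star_sum (T : finType) N x0 (e : seq T) (s : {perm T}) : rat :=
  \sum_(t <- star_products x0 e) N%:R ^+ #|porbits (s * t)|.

Lemma star_sum_cons (T : finType) N (x0 x : T) e (s : {perm T}) :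
  star_sum N x0 (x :: e) s = \sum_(j <- x0 :: e) star_sum N x0 e (tperm x j * s).
Proof.
rewrite /star_sum star_products_cons big_allpairs_dep.
apply: eq_bigr => j _; apply: eq_bigr => t _.
by rewrite mulgA (card_porbits_mulC _ (tperm x j)) mulgA.
Qed.

(** Both [s] and the earlier products fix [x], so each of the [size e + 1] choices of [j] lowers the
    number of cycles by one. *)
Lemma star_sum_fixed (T : finType) N (x0 x : T) e (s : {perm T}) :
  x \notin x0 :: e -> s x = x ->
  N%:R * star_sum N x0 (x :: e) s = (size e).+1%:R * star_sum N x0 e s.
Proof.
move=> xE sx; rewrite star_sum_cons mulr_sumr.
have -> : (size e).+1%:R * star_sum N x0 e s = \sum_(j <- x0 :: e) star_sum N x0 e s.
  by rewrite big_const_seq count_predT iter_addr_0 mulr_natl.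
rewrite big_seq [RHS]big_seq; apply: eq_bigr => j jE.
rewrite /star_sum mulr_sumr big_seq [RHS]big_seq; apply: eq_bigr => t tE.
rewrite -mulgA -exprS card_porbits_mul_fixed //.
  by rewrite permM sx (star_product_fix tE).
by apply: contraNneq xE => ->.
Qed.

(** The counterpart of [cycle_coef_rec]: the choice [j = k] undoes [tperm x k], and any other choice
    costs one cycle, which the factor [N] on the left restores. *)
Lemma star_sum_moved (T : finType) N (x0 x k : T) e (s : {perm T}) :
  x \notin x0 :: e -> uniq (x0 :: e) -> s x = x -> k \in x0 :: e ->
  N%:R * star_sum N x0 (x :: e) (tperm x k * s) =
    N%:R * star_sum N x0 e s +
    \sum_(j <- x0 :: e | j != k) star_sum N x0 e (tperm j k * s).
Proof.
move=> xE uE sx kE; rewrite star_sum_cons.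
rewrite (bigD1_seq k) //= tpermKg mulrDr; congr (_ + _).
rewrite mulr_sumr big_seq_cond [RHS]big_seq_cond; apply: eq_bigr => j /andP[jE jk].
have xj : x != j by apply: contraNneq xE => ->.
have xk : x != k by apply: contraNneq xE => ->.
rewrite /star_sum mulr_sumr big_seq [RHS]big_seq; apply: eq_bigr => t tE.
(* (x j)(x k) = (x k)(j k), and the factor (x k) then only absorbs the fixed
   point x into another cycle. *)
have -> : (tperm x j * (tperm x k * s) * t =
  tperm x k * (tperm j k * s * t))%g.
  rewrite !mulgA; congr (_ * _ * _)%g.
  by rewrite conjgC tpermJ tpermL tpermD 1?[k == j]eq_sym // (tpermC j k).
rewrite -exprS card_porbits_mul_fixed // !permM tpermD 1?eq_sym //.
by rewrite sx (star_product_fix tE).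
Qed.

Lemma coef_1DX_exp N j : ((1 + 'X : {poly rat}) ^+ N)`_j = 'C(N, j)%:R.
Proof.
rewrite exprDn coef_sum.
under eq_bigr => i _ do rewrite expr1n mul1r coefMn coefXn.
have [jN|Nj] := ltnP j N.+1; last first.
  rewrite bin_small // big1 // => i _.
  by rewrite gtn_eqF ?mul0rn // (leq_trans (ltn_ord i)).
rewrite (bigD1 (Ordinal jN)) //= eqxx big1 ?addr0 // => i.
by rewrite -val_eqE eq_sym /= => /negbTE ->; rewrite mul0rn.
Qed.

Lemma cycle_coef1 (T : finType) N : cycle_coef N (1 : {perm T}) = N%:R.
Proof.
rewrite /cycle_coef.
have -> : cycle_poly (porbits (1 : {perm T})) = 'X^#|T|.
  have fx (x : T) : porbit 1%g x = [set x] by rewrite fixed_porbit ?perm1.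
  rewrite /cycle_poly (eq_bigr (fun=> 'X)) => [|C /imsetP[x _ ->]]; last first.
    by rewrite fx cards1 expr1; ring.
  rewrite prodr_const card_imset // => x y; rewrite !fx; exact: set1_inj.
by rewrite coefMXn ltnNge leqnSn /= subSnn coef_1DX_exp bin1.
Qed.

(** Induction on [e], both sides obeying the same recursion. The unequal powers of [N] account for
    the points outside [x0 :: e], each a cycle by itself. *)
Lemma star_sumE (T : finType) N (x0 : T) e (s : {perm T}) :
  uniq (x0 :: e) -> (forall z, z \notin x0 :: e -> s z = z) ->
  N%:R ^+ (size e).+1 * star_sum N x0 e s =
    (size e)`!%:R * N%:R ^+ #|T| * cycle_coef N s.
Proof.
elim: e s => [|x e IHe] s uE sE.
  have s1 : s = 1%g.
    apply/permP => z; rewrite perm1; have [->|zx0] := eqVneq z x0; last first.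
      by apply: sE; rewrite inE.
    (* Otherwise [s x0] lies outside the support, hence is fixed, and injectivity gives
       [s x0 = x0]. *)
    have [//|sx0] := eqVneq (s x0) x0.
    by apply: (@perm_inj _ s); apply: sE; rewrite inE.
  rewrite s1 /star_sum big_seq1 cycle_coef1 mulg1 expr1 mul1r mulrC; congr (_ ^+ _ * _).
  by have := @card_porbits_star_product _ x0 [::] 1%g isT; rewrite addn0 inE; apply.
have xE : x \notin x0 :: e.
  by move: uE; rewrite /= !inE !negb_or eq_sym => /andP[/andP[-> _] /andP[->]].
have uE' : uniq (x0 :: e).
  by move: uE; rewrite /= !inE !negb_or => /andP[/andP[_ ->] /andP[]].
have sE' z : z \notin x0 :: e -> z != x -> s z = z.
  by rewrite inE negb_or => /andP[z0 ze] zx; apply: sE; rewrite !inE !negb_or z0 zx.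
rewrite [size _]/= exprSr -mulrA.
have [sx|sx] := eqVneq (s x) x.
  rewrite star_sum_fixed // mulrCA IHe //; first by rewrite factS natrM !mulrA.
  by move=> z zE; have [->|] := eqVneq z x => //; apply: sE'.
(* Deleting [x] from its cycle in [s] gives [t]. *)
pose k := (s^-1)%g x; pose t := (tperm x k * s)%g.
have sk : s k = x by rewrite permKV.
have xk : x != k by apply: contraNneq sx => xk; rewrite {1}xk sk.
have kE : k \in x0 :: e.
  apply/contraT => kE; have := sE' k kE; rewrite eq_sym xk sk => /(_ isT) xk'.
  by rewrite {1}xk' eqxx in xk.
have tx : t x = x by rewrite permM tpermL.
have tE z : z \notin x0 :: e -> t z = z.
  move=> zE; have [->//|zx] := eqVneq z x; rewrite permM tpermD 1?eq_sym //.
    exact: sE'.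
  by apply: contraNneq zE => ->.
have sEt : s = (tperm x k * t)%g by rewrite tpermKg.
rewrite sEt star_sum_moved // mulrDr mulrCA IHe // mulr_sumr.
have -> : \sum_(j <- x0 :: e | j != k) N%:R ^+ (size e).+1 * star_sum N x0 e (tperm j k * t) =
   \sum_(j <- x0 :: e | j != k) (size e)`!%:R * N%:R ^+ #|T| * cycle_coef N (tperm j k * t).
  rewrite big_seq_cond [RHS]big_seq_cond; apply: eq_bigr => j /andP[jE jk].
  rewrite IHe // => z zE; rewrite permM tpermD ?tE //.
    by apply: contraNneq zE => <-.
  by apply: contraNneq zE => <-.
(* In [cycle_coef_rec] the sum runs over all of [T]. Each [j] outside [x0 :: e] is fixed by [t] and
   contributes the same as [x]; moving these terms to the left turns [#|T|] into [size e + 1]. *)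
have key : (size e).+1%:R * cycle_coef N (tperm x k * t) =
    N%:R * cycle_coef N t + \sum_(j <- x0 :: e | j != k) cycle_coef N (tperm j k * t).
  have := cycle_coef_rec N tx xk; rewrite (bigID [in x0 :: e]) /=.
  have -> : \sum_(j | (j != k) && (j \notin x0 :: e)) cycle_coef N (tperm j k * t) =
      (#|T|%:R - (size e).+1%:R) * cycle_coef N (tperm x k * t).
    have -> : #|T|%:R - (size e).+1%:R = #|[predC x0 :: e]|%:R :> rat.
      rewrite -(cardC [in x0 :: e]) (card_uniqP uE') natrD addrAC subrr add0r.
      by congr (_%:R).
    rewrite mulr_natl -sumr_const; apply: eq_big => j.
      by rewrite !inE; apply: andb_idl; apply: contraNneq => ->; rewrite inE in kE.
    move=> /andP[jk jE].
    rewrite /cycle_coef; congr (nth _ (polyseq (_ * _)) _).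
    apply: (mulfI (negbT (polyX_eq0 rat))).
    by rewrite !cycle_poly_fixed ?tE.
  have -> : \sum_(j | (j != k) && (j \in x0 :: e)) cycle_coef N (tperm j k * t) =
      \sum_(j <- x0 :: e | j != k) cycle_coef N (tperm j k * t).
    rewrite [RHS]big_mkcond big_uniq // -big_mkcondr.
    by apply: eq_bigl => j; rewrite andbC.
  move=> rec.
  apply: (addIr ((#|T|%:R - (size e).+1%:R) * cycle_coef N (tperm x k * t))).
  by rewrite -addrA -rec; ring.
by rewrite -mulr_sumr mulrCA -mulrDr -key factS natrM; ring.
Qed.

(** * From the average over full cycles to [omega] *)

Lemma porbit_full (T : finType) (s : {perm T}) x :
  #|porbits s| = 1%N -> porbit s x = setT.
Proof.
move=> /eqP/cards1P[C sC]; apply/setP => y; rewrite inE -eq_porbit_mem.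
have E z : porbit s z = C by apply/set1P; rewrite -sC imset_f.
by rewrite !E eqxx.
Qed.

(** The conjugating map sends [iter i s x0] to [iter i t x0]. *)
Lemma full_cycle_conj (T : finType) (s t : {perm T}) :
  #|porbits s| = 1%N -> #|porbits t| = 1%N -> exists c, t = (s ^ c)%g.
Proof.
move=> s1 t1.
have [x0 _|T0] := pickP T; last first.
  by exists 1%g; apply/permP => x; have := T0 x.
have sn : #|porbit s x0| = #|T| by rewrite porbit_full // cardsT.
have tn : #|porbit t x0| = #|T| by rewrite porbit_full // cardsT.
pose i x := index x (traject s x0 #|T|).
have iE x : (i x < #|T|)%N /\ iter (i x) s x0 = x.
  have xs : x \in traject s x0 #|T| by rewrite -sn -porbit_traject porbit_full ?inE.
  have ix : (i x < #|T|)%N by move: xs; rewrite -index_mem size_traject.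
  by split=> //; rewrite -(nth_traject s ix) nth_index.
have iK l : (l < #|T|)%N -> i (iter l s x0) = l.
  move=> lT; have [iT E] := iE (iter l s x0).
  by apply: (@iter_porbit_inj _ s x0); rewrite ?inE ?sn.
pose f x := iter (i x) t x0.
have f_inj : injective f.
  move=> x y xy; have [xT xE] := iE x; have [yT yE] := iE y.
  rewrite -xE -yE; congr (iter _ _ _).
  by apply: (@iter_porbit_inj _ t x0); rewrite ?inE ?tn.
exists (perm f_inj); apply/permP => y.
rewrite -[y in LHS](permKV (perm f_inj)) -[y in RHS](permKV (perm f_inj)).
move: (_ y) => x; rewrite permJ !permE /f; have [xT xE] := iE x.
have sxE : s x = iter (i x).+1 s x0 by rewrite iterS xE.
have [xlt|xge] := ltnP (i x).+1 #|T|.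
  by rewrite sxE iK.
(* At the last position both cycles return to [x0]. *)
have xn : (i x).+1 = #|T| by apply/eqP; rewrite eqn_leq xT.
have T_gt0 : (0 < #|T|)%N by rewrite -xn.
rewrite sxE -iterS xn -{2}sn iter_porbit -{1}tn iter_porbit.
by rewrite (iK 0%N T_gt0).
Qed.

Lemma geq_total : total geq.
Proof. by move=> x y; rewrite /geq leq_total. Qed.

Lemma geq_trans : transitive geq.
Proof. by move=> x y z yx xz; apply: leq_trans xz yx. Qed.

Lemma geq_anti : antisymmetric geq.
Proof. by move=> x y; rewrite /geq andbC => /anti_leq. Qed.

Lemma cycle_type_conj n (s c : 'S_n) : cycle_type (s ^ c) = cycle_type s.
Proof.
apply/(perm_sortP geq_total geq_trans geq_anti).
have sub : perm_eq (enum (porbits (s ^ c)))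
     [seq c @: C | C : {set 'I_n} <- enum (porbits s)].
  apply: uniq_perm; rewrite ?enum_uniq ?map_inj_uniq ?enum_uniq //.
    exact/imset_inj/perm_inj.
  move=> C; rewrite mem_enum porbits_conj.
  by apply/imsetP/mapP => -[D Ds ->]; exists D; rewrite ?mem_enum // -mem_enum.
apply: (perm_trans (perm_map _ sub)); rewrite -map_comp.
rewrite (eq_map (_ : _ =1 fun X : {set 'I_n} => #|X|)) // => C /=.
by rewrite card_imset //; exact: perm_inj.
Qed.

Lemma porbits_omega n : #|porbits (omega n.+1)| = 1%N.
Proof.
apply/eqP/cards1P; exists (porbit (omega n.+1) ord0).
apply/setP => C; rewrite inE; apply/imsetP/eqP => [[x _ ->]|->]; last by exists ord0.
apply/eqP; rewrite eq_porbit_mem; apply/porbitP; exists x.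
have E i : (i <= n)%N -> val (((omega n.+1) ^+ i)%g ord0) = i.
  elim: i => [|i IHi] i_le; first by rewrite expg0 perm1.
  by rewrite expgSr permM permE /= IHi 1?ltnW // modn_small.
by apply: val_inj; rewrite E // -ltnS ltn_ord.
Qed.

Lemma sum_class_omega n N g : (0 < N)%N ->
  \sum_(s in conj_class n.+1 g) N%:R ^+ #|porbits (omega n.+1 * s^-1)| =
  \sum_(s in conj_class n.+1 g) cycle_coef N s.
Proof.
(* Now [ord0 :: e] lists all points, so [star_sumE] applies to every [s] and its powers of [N]
   cancel. *)
move=> N_gt0; pose e := rem ord0 (enum 'I_n.+1).
have ue : uniq (ord0 :: e).
  by rewrite -(perm_uniq (perm_to_rem (mem_enum _ ord0))) enum_uniq.
have memE z : z \in ord0 :: e.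
  by rewrite -(perm_mem (perm_to_rem (mem_enum _ ord0))) mem_enum.
have size_e : size e = n.
  by have := perm_size (perm_to_rem (mem_enum 'I_n.+1 ord0)); rewrite -cardE card_ord => -[].
have Nn0 k : N%:R ^+ k != 0 :> rat by rewrite expf_neq0 // pnatr_eq0 -lt0n.
have star s : star_sum N ord0 e s = n`!%:R * cycle_coef N s :> rat.
  apply: (mulfI (Nn0 n.+1)); have := @star_sumE _ N ord0 e s ue.
  rewrite size_e card_ord => ->; first by rewrite mulrAC mulrC mulrA.
  by move=> z; rewrite memE.
have fn0 : n`!%:R != 0 :> rat by rewrite pnatr_eq0 -lt0n fact_gt0.
apply: (mulfI fn0); rewrite [RHS]mulr_sumr.
(* A permutation and its inverse have the same cycles, hence the same coefficient. *)
under [RHS]eq_bigr => s _ do rewrite /cycle_coef -porbitsV -/(cycle_coef N s^-1) -star.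
rewrite /star_sum exchange_big /=.
(* The left-hand side is spread over the [n!] products [t]. Each [t] is a conjugate of [omega], and
   conjugation preserves the class, so the sums agree for every [t]. *)
have -> : n`! = size (star_products ord0 e) by rewrite size_star_products size_e.
rewrite mulr_natl -count_predT -iter_addr_0 -big_const_seq.
rewrite big_seq [RHS]big_seq; apply: eq_bigr => t tL.
have t1 : #|porbits t| = 1%N.
  by have := card_porbits_star_product ue tL; rewrite card_ord size_e; lia.
have [c ->] := full_cycle_conj (porbits_omega n) t1.
rewrite [RHS](reindex_inj (conjg_inj c)) /=; apply: eq_big => s.
  by rewrite !inE cycle_type_conj.
move=> _; rewrite -conjVg -conjMg card_porbits_conj.
by rewrite card_porbits_mulC.
Qed.

(** * Coefficients of the polynomial of a cycle type *)

Definition type_poly (g : seq nat) : {poly rat} := \prod_(i <- g) ((1 + 'X) ^+ i - 1).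

Lemma cycle_poly_type n (s : 'S_n) : cycle_poly (porbits s) = type_poly (cycle_type s).
Proof.
rewrite /type_poly /cycle_type (perm_big _ (permEl (perm_sort _ _))) /= big_map.
by rewrite big_enum.
Qed.

Lemma coef_type_poly n g k : all (leq^~ n) g ->
  (type_poly g)`_k =
  \sum_(kk : {ffun 'I_(size g) -> 'I_n.+2}
         | (\sum_(i < size g) (kk i : nat) == k)%N && [forall i, (0 < kk i)%N])
     \prod_(i < size g) ('C(nth 0%N g i, kk i))%:R.
Proof.
move=> gn; rewrite /type_poly (big_nth 0%N) big_mkord.
(* The factor [(0 < l)] removes the constant term, as subtracting 1 does. The bound on the parts
   makes the range ['I_n.+2] contain all exponents. *)
pose F i (l : 'I_n.+2) : {poly rat} :=
  ((0 < l)%N%:R * ('C(nth 0%N g i, l))%:R) *: 'X^l.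
have -> : \prod_(i < size g) ((1 + 'X) ^+ nth 0%N g i - 1) =
    \prod_(i < size g) \sum_(l < n.+2) F i l.
  apply: eq_bigr => i _; apply/polyP => d; rewrite coefB coef_1DX_exp coef_sum coef1.
  have gi : (nth 0%N g i <= n)%N by move/allP: gn; apply; apply: mem_nth.
  under eq_bigr => l _ do rewrite coefZ coefXn.
  have [dn|nd] := ltnP d n.+2; last first.
    rewrite bin_small; last by lia.
    rewrite gtn_eqF ?subr0 ?big1 //; last by lia.
    by move=> l _; rewrite gtn_eqF ?mulr0 // (leq_trans (ltn_ord l)).
  rewrite (bigD1 (Ordinal dn)) //= eqxx mulr1 big1 ?addr0 => [|l]; last first.
    by rewrite -val_eqE eq_sym /= => /negbTE ->; rewrite mulr0.
  by case: (d) => [|d']; rewrite ?bin0 ?subrr ?mul0r ?subr0 ?mul1r.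
rewrite bigA_distr_bigA coef_sum [RHS]big_mkcond; apply: eq_bigr => kk _.
rewrite /F scaler_prod -expr_sum coefZ coefXn big_split /= eq_sym.
case: eqP => _; rewrite ?mulr0 ?mulr1 //=.
case: forallP => [kk0|/forallP]; first by rewrite big1 ?mul1r // => i _; rewrite kk0.
by rewrite negb_forall => /existsP[i /negbTE ki]; rewrite (bigD1 i) //= ki !mul0r.
Qed.

(** * Stirling numbers and binomial coefficients *)

(** This makes left multiplication by [tperm x k] a bijection from the permutations of [E] to those
    of [x |: E] in which [k] precedes [x]; [k = x] means that [x] is fixed. *)
Lemma perm_onD1_mul (T : finType) (E : {set T}) x k (t : {perm T}) :
  x \notin E -> k \in x |: E ->
  (perm_on (x |: E) (tperm x k * t)%g && (((tperm x k * t)%g^-1)%g x == k)) =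
  perm_on E t.
Proof.
move=> xE kE; rewrite invMg tpermV permM.
have -> : (tperm x k (t^-1%g x) == k) = (t x == x).
  by rewrite (canF_eq (tpermK _ _)) tpermR (canF_eq (permKV t)) eq_sym.
have tp : perm_on (x |: E) (tperm x k).
  apply/subsetP => z; rewrite inE; apply: contraNT => zE.
  by rewrite tpermD //; apply: contraNneq zE => <-; rewrite ?setU11.
have -> : perm_on (x |: E) (tperm x k * t)%g = perm_on (x |: E) t.
  by apply/idP/idP => [/(perm_onM tp)|/(perm_onM tp)//]; rewrite tpermKg.
apply/andP/idP => [[/subsetP tE /eqP tx]|tE].
  apply/subsetP => z; rewrite inE => tz; have := tE z; rewrite !inE => /(_ tz).
  by case/predU1P=> // zx; rewrite zx tx eqxx in tz.
split; last by rewrite (out_perm tE).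
by apply: subset_trans tE _; apply: subsetUr.
Qed.

(** A new point either forms its own cycle, with factor [x], or is inserted after one of the present
    points. Varying the support inside one type [T] allows induction; the outer powers of [x]
    account for the points outside [E]. *)
Lemma sum_perm_on_cycles (T : finType) (E : {set T}) (x : rat) :
  x ^+ #|E| * \sum_(s : {perm T} | perm_on E s) x ^+ #|porbits s| =
  x ^+ #|T| * \prod_(i < #|E|) (x + i%:R).
Proof.
have [n] := ubnP #|E|; elim: n E => // n IHn E /ltnSE leEn.
have [->|[y yE]] := set_0Vmem E.
  rewrite cards0 expr0 mul1r big_ord0 mulr1 (big_pred1 1%g) => [|s]; last first.
    apply/idP/eqP => [s0|->]; last exact: perm_on1.
    by apply/permP => z; rewrite perm1 (out_perm s0) ?inE.
  by rewrite card_porbits1.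
pose A := E :\ y; have yA : y \notin A by rewrite !inE eqxx.
have EA : E = y |: A by rewrite setD1K.
have cE : #|E| = #|A|.+1 by rewrite (cardsD1 y) yE.
have rec : x * \sum_(s : {perm T} | perm_on E s) x ^+ #|porbits s| =
    (x + #|A|%:R) * \sum_(s : {perm T} | perm_on A s) x ^+ #|porbits s|.
  rewrite (partition_big (fun s : {perm T} => (s^-1)%g y) [in E]) /=; last first.
    by move=> s sE; rewrite -(perm_closed _ sE) permKV.
  have kP k : k \in E -> \sum_(s : {perm T} | perm_on E s && ((s^-1)%g y == k)) x ^+ #|porbits s|
      = \sum_(s : {perm T} | perm_on A s) x ^+ #|porbits (tperm y k * s)|.
    move=> kE; rewrite (reindex_inj (mulgI (tperm y k))); apply: eq_bigl => s.
    by rewrite EA perm_onD1_mul // -EA.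
  rewrite (eq_bigr _ kP) EA big_setU1 //= mulrDr mulrDl.
  congr (_ * _ + _).
    by apply: eq_bigr => s _; rewrite tperm1 mul1g.
  rewrite mulr_natl -sumr_const mulr_sumr; apply: eq_bigr => k kA.
  rewrite mulr_sumr; apply: eq_bigr => s sA.
  rewrite -exprS card_porbits_mul_fixed // ?(out_perm sA) //.
  by apply: contraNneq yA => ->.
rewrite cE exprSr -mulrA rec mulrCA IHn; last by move: leEn; rewrite cE; lia.
by rewrite big_ord_recr /=; ring.
Qed.

Lemma sum_stirling1 j (x : rat) : x != 0 ->
  \sum_(m < j.+1) (stirling1 j m)%:R * x ^+ m = \prod_(i < j) (x + i%:R).
Proof.
move=> x0; apply: (@mulfI _ (x ^+ j)); first by rewrite expf_neq0.
have := sum_perm_on_cycles [set: 'I_j] x; rewrite cardsT card_ord => <-.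
congr (_ * _); rewrite [RHS](eq_bigl xpredT) => [|s]; last first.
  by apply/subsetP => z _; rewrite inE.
have cle (s : 'S_j) : (#|porbits s| < j.+1)%N.
  by rewrite ltnS (leq_trans (leq_imset_card _ _)) ?card_ord.
rewrite [RHS](partition_big (fun s => Ordinal (cle s)) xpredT) //=.
apply: eq_bigr => m _.
rewrite (eq_bigr (fun=> x ^+ m)) => [|s /eqP <- //].
rewrite sumr_const mulr_natl; congr (_ *+ _).
by apply: eq_card => s; rewrite !inE.
Qed.

Lemma natr_ffact N j : (N ^_ j)%:R = \prod_(i < j) (N%:R - i%:R) :> rat.
Proof.
elim: j => [|j IHj]; first by rewrite big_ord0.
rewrite big_ord_recr /= -IHj ffactnSr natrM.
have [jN|Nj] := leqP j N; first by rewrite natrB.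
by rewrite ffact_small // !mul0r.
Qed.

(** The rising factorial at [-N] is, up to the sign [(-1)^j], the falling factorial of [N]. *)
Lemma bin_stirling1 N j : (0 < N)%N ->
  ('C(N, j))%:R =
  \sum_(m < j.+1) (-1) ^+ (j + m) * (stirling1 j m)%:R / j`!%:R * N%:R ^+ m :> rat.
Proof.
move=> N0; have f0 : j`!%:R != 0 :> rat by rewrite pnatr_eq0 -lt0n fact_gt0.
apply: (mulIf f0); rewrite -natrM bin_ffact natr_ffact.
have := @sum_stirling1 j (- N%:R); rewrite oppr_eq0 pnatr_eq0 -lt0n N0 => /(_ isT).
have -> : \prod_(i < j) (- N%:R + i%:R) = (-1) ^+ j * \prod_(i < j) (N%:R - i%:R) :> rat.
  rewrite -[X in (-1) ^+ X](card_ord j) -prodrN; apply: eq_bigr => i _.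
  by rewrite opprB addrC.
move/(congr1 ( *%R ((-1) ^+ j))); rewrite mulrA -expr2 sqrr_sign mul1r => <-.
rewrite mulr_sumr mulr_suml; apply: eq_bigr => m _.
by rewrite (exprNn N%:R) exprD; field.
Qed.

(** * Comparison of polynomials in [N] *)

Lemma poly_eq_nat (p q : {poly rat}) :
  (forall N, (0 < N)%N -> p.[N%:R] = q.[N%:R]) -> p = q.
Proof.
move=> pq; apply/eqP; rewrite -subr_eq0; apply/eqP.
apply: (@roots_geq_poly_eq0 _ _ [seq i%:R | i <- iota 1 (size (p - q))]).
- apply/allP => _ /mapP[i + ->]; rewrite mem_iota => /andP[i0 _].
  by rewrite rootE hornerD hornerN pq // subrr.
- rewrite map_inj_in_uniq ?iota_uniq // => i j _ _ /eqP.
  by rewrite eqr_nat => /eqP.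
- by rewrite size_map size_iota.
Qed.

Lemma sum_mu n g N :
  \sum_(m < n.+1) (mu n m g)%:R * N%:R ^+ m =
  \sum_(s in conj_class n g) N%:R ^+ #|porbits (omega n * s^-1)| :> rat.
Proof.
have cle (s : 'S_n) : (#|porbits s| < n.+1)%N.
  by rewrite ltnS (leq_trans (leq_imset_card _ _)) ?card_ord.
rewrite [RHS](partition_big (fun s => Ordinal (cle (omega n * s^-1)%g)) xpredT) //=.
apply: eq_bigr => m _.
rewrite (eq_bigr (fun=> N%:R ^+ m)) => [|s /andP[_ /eqP <-] //].
rewrite sumr_const mulr_natl; congr (_ *+ _).
by apply: eq_card => s; rewrite inE unfold_in inE.
Qed.

Lemma sum_class_type n g N : (0 < N)%N ->
  \sum_(s in conj_class n.+1 g) N%:R ^+ #|porbits (omega n.+1 * s^-1)| =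
  #|conj_class n.+1 g|%:R * \sum_(j < n.+3) ('C(N, j))%:R * (type_poly g)`_(n.+2 - j).
Proof.
move=> N0; rewrite sum_class_omega // mulr_natl -sumr_const; apply: eq_bigr => s.
rewrite inE => /eqP <-; rewrite /cycle_coef cycle_poly_type coefM card_ord.
by apply: eq_bigr => j _; rewrite coef_1DX_exp.
Qed.

Lemma stirling1_small j m : (j < m)%N -> stirling1 j m = 0%N.
Proof.
move=> jm; apply/eqP; rewrite cards_eq0; apply/eqP/setP => s; rewrite !inE.
by rewrite ltn_eqF // (leq_ltn_trans _ jm) // (leq_trans (leq_imset_card _ _)) ?card_ord.
Qed.

Lemma mu_coef n m g : (m <= n.+1)%N ->
  (mu n.+1 m g)%:R =
  #|conj_class n.+1 g|%:R *
  \sum_(j < n.+3) (-1) ^+ (j + m) * (stirling1 j m)%:R / j`!%:R * (type_poly g)`_(n.+2 - j) :> rat.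
Proof.
move=> mn.
(* By [bin_stirling1], the value of [S j] at [N > 0] is ['C(N, j)]. *)
pose S j : {poly rat} := \poly_(i < j.+1) ((-1) ^+ (j + i) * (stirling1 j i)%:R / j`!%:R).
have E : \poly_(i < n.+2) (mu n.+1 i g)%:R =
    #|conj_class n.+1 g|%:R *: \sum_(j < n.+3) (type_poly g)`_(n.+2 - j) *: S j.
  apply: poly_eq_nat => N N0; rewrite horner_poly sum_mu sum_class_type // hornerZ.
  congr (_ * _); rewrite horner_sum; apply: eq_bigr => j _.
  by rewrite hornerZ horner_poly bin_stirling1 // mulrC.
have := congr1 (fun p : {poly rat} => p`_m) E; rewrite coef_poly ltnS mn => ->.
rewrite coefZ coef_sum; congr (_ * _); apply: eq_bigr => j _.
rewrite coefZ coef_poly ltnS mulrC; case: leqP => // jm.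
by rewrite stirling1_small // mulr0 !mul0r.
Qed.

Theorem theorem4p3 (n m : nat) (g : seq nat) :
  is_partition n g -> (1 <= m <= n)%N ->
  (mu n m g)%:R =
  (#|conj_class n g|)%:R *
  \sum_(k < (n - m).+1)
    ((-1) ^+ k * (stirling1 (m + k) m)%:R / ((m + k)`!)%:R *
     (\sum_(kk : {ffun 'I_(size g) -> 'I_n.+2}
             | (\sum_(i < size g) (kk i : nat) == n - m - k + 1)%N
               && [forall i, (0 < kk i)%N])
        \prod_(i < size g) ('C(nth 0%N g i, kk i))%:R) : rat).
Proof.
case: n => [|n]; first by case: m.
move=> /and3P[_ _ /eqP gn] /andP[m0 mn].
have g_le : all (leq^~ n.+1) g.
  by apply/allP => x xg; rewrite -gn sumnE (big_rem x) //= leq_addr.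
(* The partition has a positive sum, so there is at least one factor, and its constant term
   vanishes. *)
have g0 : (type_poly g)`_0 = 0.
  case: (g) gn => // i g' _; rewrite -horner_coef0 /type_poly big_cons hornerM.
  by rewrite hornerD hornerN horner_exp hornerD hornerX !hornerC addr0 expr1n subrr mul0r.
rewrite mu_coef //; congr (_ * _).
pose F j : rat := (-1) ^+ (j + m) * (stirling1 j m)%:R / j`!%:R * (type_poly g)`_(n.+2 - j).
(* The last term, [j = n + 2], contains the constant coefficient; the terms with [j < m] vanish with
   the Stirling numbers. *)
rewrite -(big_mkord xpredT F) big_nat_recr //= [F n.+2]/F subnn g0 mulr0 addr0.
rewrite (@big_cat_nat _ _ _ m) //=; last exact: leqW.
rewrite big_nat big1 ?add0r => [|j /andP[_ jm]]; last first.
  by rewrite /F stirling1_small // mulr0 !mul0r.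
(* With [j = m + k] the sign becomes [(-1)^(2m+k) = (-1)^k]. *)
rewrite -{1}[m]add0n big_addn big_mkord subSn //; apply: eq_bigr => k _.
rewrite -coef_type_poly // /F [(k + m)%N]addnC addnAC exprD -signr_odd oddD addbb mul1r.
congr (_ * _`__); have := ltn_ord k; lia.
Qed.
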